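(* Let $n\ge 2$ and let $f\in C_n$ have minimum value $m=\min_{\phi}f(\phi)>0$. Let $\bar f(\phi)=f(\phi)-m$. Then $\bar f\in C_n$ and $v(f)>v(\bar f)$.
   Context: For an integer $n\ge 2$, $C_n$ denotes the set of real cosine polynomials $f(\phi)=\sum_{k=0}^{n} a_k\cos(k\phi)$ such that (i) all coefficients $a_0,\dots,a_n$ are real and nonnegative, (ii) $a_1>a_0>0$, and (iii) $f(\phi)\ge 0$ for all real $\phi$. For $f\in C_n$ with coefficients $a_k$, $v(f)=\dfrac{f(0)-a_0}{(\sqrt{a_1}-\sqrt{a_0})^2}$. *)

(* Defs.v *)
From mathcomp Require Import all_boot all_order all_algebra.
From mathcomp Require Import ring.
From mathcomp Require Import all_classical all_reals all_analysis.

Set Implicit Arguments.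
Unset Strict Implicit.
Unset Printing Implicit Defensive.

Import Order.TTheory GRing.Theory Num.Theory.

Local Open Scope classical_set_scope.
Local Open Scope ring_scope.

(* Only the coefficients [a 0], ..., [a n] matter. *)
Definition cospoly (R : realType) (n : nat) (a : nat -> R) : R -> R :=
  fun phi => \sum_(0 <= k < n.+1) a k * cos (k%:R * phi).

Definition cosC (R : realType) (n : nat) : set (R -> R) :=
  [set f | exists a : nat -> R,
    [/\ f = cospoly n a,
        forall k, (k <= n)%N -> 0 <= a k,
        0 < a 0%N,
        a 0%N < a 1%N &
        forall phi, 0 <= f phi]].

(* The coefficients of the cosine polynomial [f]: a chosen [a] such that
   [f = cospoly n a].  By [cospoly_inj] below the values [a 0], ..., [a n] do
   not depend on the choice.  The value is junk if [f] is not of this form. *)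
Definition coscoef (R : realType) (n : nat) (f : R -> R) : nat -> R :=
  xget (fun=> 0) [set a | f = cospoly n a].

Definition v (R : realType) (n : nat) (f : R -> R) : R :=
  (f 0 - coscoef n f 0%N) /
  (Num.sqrt (coscoef n f 1%N) - Num.sqrt (coscoef n f 0%N)) ^+ 2.

Definition is_minimum (R : realType) (f : R -> R) (m : R) : Prop :=
  range f m /\ lbound (range f) m.

Lemma cospoly_eq0 (R : realType) (n : nat) (a : nat -> R) :
  (forall phi, cospoly n a phi = 0) -> forall k, (k <= n)%N -> a k = 0.
Proof.
elim: n a => [|n IH] a a0 k.
  rewrite leqn0 => /eqP ->; have := a0 0.
  by rewrite /cospoly big_nat1 mul0r cos0 mulr1.
pose s : R := pi / n.+1%:R.
(* The operator g(phi + s) + g(phi - s) - 2 cos((n+1) s) g(phi) kills the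
   top frequency and multiplies the others by nonzero scalars. *)
pose b k : R := a k * (cos (k%:R * s) + 1).
have ns : n.+1%:R * s = pi by rewrite /s mulrC divfK// pnatr_eq0.
have b0 phi : cospoly n b phi = 0.
  have: cospoly n.+1 a (phi + s) + cospoly n.+1 a (phi - s)
        + 2 * cospoly n.+1 a phi = 0 by rewrite !a0 mulr0 !addr0.
  rewrite /cospoly mulr_sumr -!big_split/= big_nat_recr//= mulrDr mulrBr ns.
  rewrite cosD cosB cospi sinpi.
  set x := cos _; set y := sin _.
  have -> : a n.+1 * (x * -1 - y * 0) + a n.+1 * (x * -1 + y * 0)
            + 2 * (a n.+1 * x) = 0 by ring.
  rewrite addr0 => S0; apply: (@mulfI _ 2); first by rewrite pnatr_eq0.
  rewrite mulr0 -[RHS]S0 mulr_sumr; apply: eq_bigr => i _.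
  by rewrite /b [_ * (phi + s)]mulrDr [_ * (phi - s)]mulrBr cosD cosB; ring.
have aS k' : (k' <= n)%N -> a k' = 0.
  move=> kn; have /eqP := IH b b0 k' kn; rewrite mulf_eq0 => /orP[/eqP//|].
  rewrite addr_eq0 -(@cospi R) => /eqP/cos_inj.
  have s_gt0 : 0 < s by rewrite divr_gt0// pi_gt0.
  have ks : k'%:R * s < pi by rewrite -ns ltr_pM2r// ltr_nat ltnS.
  move=> H; suff E : k'%:R * s = pi by rewrite E ltxx in ks.
  by apply: H; rewrite in_itv/= ?pi_ge0 ?lexx// mulr_ge0 ?ler0n ?ltW.
rewrite leq_eqVlt => /predU1P[->|]; last exact: aS.
have := a0 0; rewrite /cospoly big_nat_recr//= big_nat big1 => [|i /andP[_ i_n]].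
  by rewrite add0r mulr0 cos0 mulr1.
by rewrite aS ?mul0r.
Qed.

Lemma cospoly_inj (R : realType) (n : nat) (a b : nat -> R) :
  cospoly n a = cospoly n b -> forall k, (k <= n)%N -> a k = b k.
Proof.
move=> ab k kn; apply/eqP; rewrite -subr_eq0; apply/eqP.
apply: (@cospoly_eq0 _ n (fun k => a k - b k)) kn => phi.
rewrite /cospoly; under eq_bigr do rewrite mulrBl.
by rewrite sumrB -/(cospoly n a phi) ab subrr.
Qed.

Lemma coscoefE (R : realType) (n : nat) (a : nat -> R) (k : nat) :
  (k <= n)%N -> coscoef n (cospoly n a) k = a k.
Proof.
move=> kn; apply: (@cospoly_inj _ n) kn.
by rewrite /coscoef; case: xgetP => [x _ /= <-|/(_ a) []].
Qed.

(* Main.v *)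
(** Averaging [f] over the [n.+1] points [2 pi j / n.+1] returns [a 0], since
    each [cos (k phi)] with [1 <= k <= n] averages to zero there; the point
    [phi = 0] contributes [f 0 > a 0], so some other value is below [a 0] and
    [m < a 0].  Subtracting [m] lowers only the constant coefficient, hence
    fixes the numerator of [v] and enlarges its denominator. *)
Require Import Defs.
From mathcomp Require Import all_boot all_order all_algebra.
From mathcomp Require Import ring lra.
From mathcomp Require Import all_classical all_reals all_analysis.

Import Order.TTheory GRing.Theory Num.Theory.

Local Open Scope classical_set_scope.
Local Open Scope ring_scope.

Lemma sin_mulrn_pi (R : realType) (k : nat) : sin (k%:R * pi) = 0 :> R.
Proof.
elim: k => [|k IH]; first by rewrite mul0r sin0.
by rewrite -natr1 mulrDl mul1r sinD IH sinpi mul0r mulr0 addr0.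
Qed.

(** Dirichlet-kernel summation: the factor [sin h] makes the sum telescope. Keeping it on the left
    avoids a division, so no condition on [h] arises. *)
Lemma sum_cos (R : realType) (N : nat) (h : R) :
  sin h * (\sum_(0 <= j < N) cos (j%:R * (2 * h))) =
  sin (N%:R * h) * cos ((N%:R - 1) * h).
Proof.
elim: N => [|N IH]; first by rewrite big_nil mul0r sin0 mulr0 mul0r.
rewrite big_nat_recr//= mulrDr IH -[N.+1%:R]natr1.
(* With this splitting the inductive step becomes a polynomial identity in the sines and cosines of
   [N%:R * h] and [h]. *)
have -> : N%:R * (2 * h) = N%:R * h + N%:R * h by ring.
rewrite addrK mulrBl mulrDl mul1r sinD cosB cosD; ring.
Qed.

Lemma sum_cos_roots (R : realType) (N k : nat) : (0 < k < N)%N ->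
  \sum_(0 <= j < N) cos (k%:R * (j%:R * (2 * pi / N%:R))) = 0 :> R.
Proof.
move=> /andP[k0 kN].
have N0 : 0 < N%:R :> R by rewrite ltr0n (ltn_trans k0).
set h : R := k%:R * pi / N%:R.
under eq_bigr => j _.
  have -> : k%:R * (j%:R * (2 * pi / N%:R)) = j%:R * (2 * h) by rewrite /h; ring.
  over.
(* Since [0 < k < N], the half-step [h] lies strictly between 0 and [pi]; since [N%:R * h] is
   [k%:R * pi], the closed form vanishes. *)
have sh : sin h != 0.
  rewrite gt_eqF// sin_gt0_pi// /h divr_gt0// ?mulr_gt0 ?pi_gt0 ?ltr0n//=.
  by rewrite ltr_pdivrMr// mulrC ltr_pM2l ?pi_gt0// ltr_nat.
apply: (mulfI sh); rewrite sum_cos mulr0.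
by rewrite [N%:R * h]mulrC divfK ?gt_eqF// sin_mulrn_pi mul0r.
Qed.

Lemma mean_cospoly (R : realType) (n : nat) (a : nat -> R) :
  \sum_(0 <= j < n.+1) cospoly n a (j%:R * (2 * pi / n.+1%:R)) =
  n.+1%:R * a 0%N.
Proof.
rewrite /cospoly exchange_big_nat/= big_ltn//.
(* With [n.+1] sample points, each frequency from 1 to [n] is strictly below the number of
   points. *)
rewrite [X in _ + X]big_nat [X in _ + X]big1 => [|k kn].
  rewrite addr0; under eq_bigr do rewrite mul0r cos0 mulr1.
  by rewrite sumr_const_nat subn0 mulr_natl.
by rewrite -mulr_sumr sum_cos_roots// mulr0.
Qed.

Lemma cospoly0 (R : realType) (n : nat) (a : nat -> R) :
  cospoly n a 0 = \sum_(0 <= k < n.+1) a k.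
Proof. by apply: eq_bigr => k _; rewrite mulr0 cos0 mulr1. Qed.

Lemma cospoly0_gt (R : realType) (n : nat) (a : nat -> R) : (0 < n)%N ->
  (forall k, (k <= n)%N -> 0 <= a k) -> 0 < a 1%N -> a 0%N < cospoly n a 0.
Proof.
move=> n0 ap a1; rewrite cospoly0 big_ltn// big_ltn// ltrDl ltr_wpDr//.
by rewrite big_nat sumr_ge0// => k /andP[_ kn]; apply: ap.
Qed.

(** Removing the sample at 0 from the mean leaves [n] values whose sum is below [n%:R * a 0] and at
    least [n%:R * m]. *)
Lemma lbound_cospoly_lt (R : realType) (n : nat) (a : nat -> R) (m : R) :
  (0 < n)%N -> (forall phi, m <= cospoly n a phi) ->
  a 0%N < cospoly n a 0 -> m < a 0%N.
Proof.
move=> n0 lbm f0.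
have := mean_cospoly R n a; rewrite big_ltn// mul0r => E.
have : \sum_(1 <= j < n.+1) m <=
    \sum_(1 <= j < n.+1) cospoly n a (j%:R * (2 * pi / n.+1%:R)).
  by apply: ler_sum => j _; apply: lbm.
rewrite sumr_const_nat subSS subn0 -[m *+ n]mulr_natl => le_m.
have n0R : 0 < n%:R :> R by rewrite ltr0n.
by rewrite -(ltr_pM2l n0R); move: E; rewrite -[X in _ = X * _]natr1; lra.
Qed.

Lemma cospoly_sub_cst (R : realType) (n : nat) (a : nat -> R) (m : R) :
  (fun phi => cospoly n a phi - m) =
  cospoly n (fun k => if k is 0%N then a 0%N - m else a k).
Proof.
apply/funext => phi; rewrite /cospoly [LHS]addrC.
rewrite big_ltn// [RHS]big_ltn// mul0r cos0 !mulr1 addrA [- m + _]addrC.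
by congr (_ + _); apply: eq_big_nat => -[].
Qed.

Theorem theorem2p2 (R : realType) (n : nat) (hn : (2 <= n)%N)
    (f : R -> R) (hf : cosC n f)
    (m : R) (hm : is_minimum f m) (m_gt0 : 0 < m) :
  let fbar : R -> R := fun phi => f phi - m in
  cosC n fbar /\ v n f > v n fbar.
Proof.
have n0 : (0 < n)%N by exact: ltnW.
case: hf => a [-> a_ge0 a0 a01 f_ge0] in hm * => fbar.
have lbm phi : m <= cospoly n a phi by apply: hm.2; exists phi.
have f0 : a 0%N < cospoly n a 0.
  by apply: cospoly0_gt => //; exact: lt_trans a01.
have ma0 : m < a 0%N by apply: lbound_cospoly_lt lbm f0.
have fbarE : fbar = _ := cospoly_sub_cst _ _ a m.
split.
  rewrite fbarE; eexists; split; first by [].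
  - by case=> [_|k kn]; [rewrite subr_ge0 ltW | exact: a_ge0].
  - by rewrite subr_gt0.
  - by rewrite ltrBlDr (lt_trans a01)// ltrDl.
  - by move=> phi; rewrite -cospoly_sub_cst subr_ge0.
have c0 : coscoef n fbar 0%N = a 0%N - m by rewrite fbarE coscoefE.
have c1 : coscoef n fbar 1%N = a 1%N by rewrite fbarE coscoefE.
(* The two shifts by [m] cancel, so both quotients now have the numerator [cospoly n a 0 - a 0],
   positive by [f0]; only the denominators remain to be compared. *)
rewrite /v c0 c1 !coscoefE// /fbar opprB addrA subrK.
have s01 : Num.sqrt (a 0%N) < Num.sqrt (a 1%N).
  by rewrite ltr_sqrt// (lt_trans a0).
have sm0 : Num.sqrt (a 0%N - m) < Num.sqrt (a 0%N).
  by rewrite ltr_sqrt// ltrBlDr ltrDl.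
have sm1 := lt_trans sm0 s01.
rewrite ltr_pM2l ?subr_gt0// ltf_pV2 ?posrE ?exprn_gt0 ?subr_gt0//.
by rewrite ltr_pXn2r ?nnegrE ?subr_ge0 ?(ltW s01) ?(ltW sm1)// ltrD2l ltrN2.
Qed.
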